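(* Let $G$ be a finite group, $\mathcal{R}$ a principal ideal domain containing $\mathbb{Z}$ with field of fractions $\mathcal{K}$, and $\Theta=\sum_i H_i-\sum_j H_j'$ an $AG$-relation, where $A$ is either $\mathbb{Q}$ or $\mathbb{Z}_{(p)}$ for a prime $p$. Let $\Gamma$ be an $\mathcal{R}[G]$-module, free of finite rank over $\mathcal{R}$, such that $\Gamma\otimes_{\mathcal R}\mathcal{K}$ is self-dual. Put $S_1=\bigsqcup_i G/H_i$ and $S_2=\bigsqcup_j G/H_j'$, and fix an injection of $\mathcal{R}[G]$-modules $\phi:\mathcal{R}[S_1]\hookrightarrow\mathcal{R}[S_2]$. Let $$\phi_G^*:\mathrm{Hom}_{\mathcal{R}[G]}(\mathcal{R}[S_2],\Gamma)\to\mathrm{Hom}_{\mathcal{R}[G]}(\mathcal{R}[S_1],\Gamma),\qquad (\phi^{\mathrm{tr}})_G^*:\mathrm{Hom}_{\mathcal{R}[G]}(\mathcal{R}[S_1],\Gamma)\to\mathrm{Hom}_{\mathcal{R}[G]}(\mathcal{R}[S_2],\Gamma)$$ be the maps given by pre-composition with $\phi$ and with its transpose $\phi^{\mathrm{tr}}:\mathcal{R}[S_2]\hookrightarrow\mathcal{R}[S_1]$. Fix a $G$-invariant non-degenerate bilinear pairing $\langle\,,\rangle$ on $\Gamma$. Then $$\frac{\det(\phi^{\mathrm{tr}})_G^*}{\det\phi_G^*}\equiv\frac{\prod_i\det\left(\frac{1}{|H_i|}\langle\,,\rangle\,\big|\,\Gamma^{H_i}\right)}{\prod_j\det\left(\frac{1}{|H_j'|}\langle\,,\rangle\,\big|\,\Gamma^{H_j'}\right)}\mod(\mathcal{R}^\times)^2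 .$$
   Context: An $AG$-relation is a formal expression $\Theta=\sum_i H_i-\sum_j H_j'$ in subgroups of $G$ (up to conjugacy, repetitions allowed) such that $\bigoplus_i A[G/H_i]\cong\bigoplus_j A[G/H_j']$ as $A[G]$-modules. The transpose $\phi^{\mathrm{tr}}$ is the dual map $\mathrm{Hom}(\mathcal{R}[S_2],\mathcal{R})\to\mathrm{Hom}(\mathcal{R}[S_1],\mathcal{R})$, where the permutation modules $\mathcal{R}[S_1]$, $\mathcal{R}[S_2]$ are identified with their duals via the standard bases $S_1$, $S_2$ and the dual bases; so its matrix in the standard bases is the transpose of that of $\phi$. The two Hom-modules are $\mathcal{R}$-free of the same finite rank; both determinants $\det\phi_G^*$ and $\det(\phi^{\mathrm{tr}})_G^*$ are computed with respect to the same fixed pair of $\mathcal{R}$-bases of these two modules. The pairing takes values in some field extension of $\mathcal{K}$; the determinants of the pairing are Gram determinants with respect to arbitrary $\mathcal{R}$-bases of the ($\mathcal{R}$-free) fixed submodules. *)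

(* Defs.v *)
From HB Require Import structures.
From mathcomp Require Import all_boot all_order all_algebra all_fingroup.
From mathcomp Require Import mxrepresentation sesquilinear.

Set Implicit Arguments.
Unset Strict Implicit.
Unset Printing Implicit Defensive.

Import GRing.Theory.
Local Open Scope ring_scope.

(* Ideals are arbitrary (Prop-valued) subsets, not only decidable ones. *)
Definition is_ideal (R : idomainType) (I : R -> Prop) : Prop :=
  [/\ I 0, forall x y, I x -> I y -> I (x + y)
    & forall a x, I x -> I (a * x)].

Definition principal_ideal_domain (R : idomainType) : Prop :=
  forall I : R -> Prop, is_ideal I ->
    exists a, forall x, I x <-> exists r, x = r * a.

Definition contains_int (R : idomainType) : Prop :=
  injective (fun z : int => z%:~R : R).

(* Z_(p) as a subring of rat. For p prime, "coprime to p" means "not divisible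
   by p"; with coprime the set below is a subring for every p. *)
Definition Zloc_pred (p : nat) : pred rat := fun q => coprime p `|denq q|%N.

Lemma denq_dvd (q : rat) (n d : int) : q * d%:~R = n%:~R -> (denq q %| d)%Z.
Proof.
rewrite -{1}[q]divq_num_den mulrAC => /(canRL (mulfVK _)).
rewrite intr_eq0 denq_neq0 -!intrM => /(_ isT)/intr_inj e.
rewrite -(@Gauss_dvdzr _ (numq q)); first by rewrite e dvdz_mull.
by rewrite coprimez_sym coprimezE coprime_num_den.
Qed.

Lemma Zloc_subring p : subring_closed (Zloc_pred p).
Proof.
have step (q1 q2 q : rat) (n : int) : q * (denq q1 * denq q2)%:~R = n%:~R ->
    Zloc_pred p q1 -> Zloc_pred p q2 -> Zloc_pred p q.
  move=> /denq_dvd; rewrite dvdzE abszM => dv c1 c2.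
  by apply: coprime_dvdr dv _; rewrite coprimeMr; apply/andP.
have E (q : rat) : q * (denq q)%:~R = (numq q)%:~R.
  by rewrite -{1}[q]divq_num_den mulfVK // intr_eq0 denq_neq0.
split=> [|q1 q2|q1 q2]; first by rewrite unfold_in /Zloc_pred coprimen1.
  apply: (step _ _ _ (numq q1 * denq q2 - numq q2 * denq q1)).
  by rewrite intrB !intrM -!E mulrBl !mulrA [_ * _ * (denq q1)%:~R]mulrAC.
apply: (step _ _ _ (numq q1 * numq q2)).
by rewrite !intrM -!E mulrACA.
Qed.

HB.instance Definition _ p :=
  GRing.isSubringClosed.Build rat (Zloc_pred p) (Zloc_subring p).

Record Zloc (p : nat) := MkZloc { Zloc_val : rat; _ : Zloc_pred p Zloc_val }.

HB.instance Definition _ p := [isSub for @Zloc_val p].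
HB.instance Definition _ p := [Choice of Zloc p by <:].
HB.instance Definition _ p := [SubChoice_isSubComNzRing of Zloc p by <:].

Section Bases.

Variable R : comNzRingType.

(* b is an R-basis of the submodule { v | P v } of V *)
Definition is_basis (V : lmodType R) (P : V -> Prop) (r : nat) (b : 'I_r -> V) :
    Prop :=
  (forall k, P (b k)) /\
  (forall v, P v -> exists! c : 'rV[R]_r, v = \sum_k c 0 k *: b k).

(* M is the matrix of T with respect to the families b (source), c (target) *)
Definition is_matrix_of (V W : lmodType R) (T : V -> W) (r : nat)
    (b : 'I_r -> V) (c : 'I_r -> W) (M : 'M[R]_r) : Prop :=
  forall k, T (b k) = \sum_l M l k *: c l.

End Bases.

Section PermutationModules.

Variable gT : finGroupType.

(* the left G-set G/H, for G the whole group gT *)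
Definition cosets (H : {group gT}) : finType :=
  {C : {set gT} | C \in lcosets H [set: gT]}.

Lemma cosets_act_subproof (H : {group gT}) (g : gT) (C : cosets H) :
  (g *: val C)%g \in lcosets H [set: gT].
Proof.
case: C => _ /= /lcosetsP[x _ ->]; apply/lcosetsP; exists (g * x)%g => //.
by rewrite lcosetM.
Qed.

Definition cosets_act (H : {group gT}) (g : gT) (C : cosets H) : cosets H :=
  Sub ((g *: val C)%g) (cosets_act_subproof g C).

(* the left G-set \bigsqcup_i G/H_i *)
Definition coset_sum (m : nat) (H : 'I_m -> {group gT}) : finType :=
  {i : 'I_m & cosets (H i)}.

Definition coset_sum_act (m : nat) (H : 'I_m -> {group gT}) (g : gT)
    (s : coset_sum H) : coset_sum H :=
  Tagged (fun i => cosets (H i)) (cosets_act g (tagged s)).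

(* A[S], for S = \bigsqcup_i G/H_i: v stands for \sum_s v s . s *)
Definition perm_module (A : comNzRingType) (m : nat) (H : 'I_m -> {group gT}) :
    vectType A := {ffun coset_sum H -> A^o}.

Section Action.

Variables (A : comNzRingType) (m : nat) (H : 'I_m -> {group gT}).

Definition perm_act (g : gT) (v : perm_module A H) : perm_module A H :=
  [ffun s => (v : {ffun _ -> _}) (coset_sum_act g^-1 s)].

Definition perm_delta (s : coset_sum H) : perm_module A H :=
  [ffun t => (t == s)%:R].

End Action.

Definition equivariant (U V : Type) (actU : gT -> U -> U) (actV : gT -> V -> V)
    (f : U -> V) : Prop :=
  forall g u, f (actU g u) = actV g (f u).

Definition is_relation (A : comNzRingType) (m1 m2 : nat)
    (H1 : 'I_m1 -> {group gT}) (H2 : 'I_m2 -> {group gT}) : Prop :=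
  exists f : 'Hom(perm_module A H1, perm_module A H2),
    bijective f /\ equivariant (@perm_act A m1 H1) (@perm_act A m2 H2) f.

Section Transpose.

Variables (R : comNzRingType) (m1 m2 : nat).
Variables (H1 : 'I_m1 -> {group gT}) (H2 : 'I_m2 -> {group gT}).
Variable phi : 'Hom(perm_module R H1, perm_module R H2).

Definition transpose_fun (v : perm_module R H2) : perm_module R H1 :=
  [ffun s => \sum_t (v : {ffun _ -> _}) t
                    * (phi (perm_delta R s) : {ffun _ -> _}) t].

Lemma transpose_is_linear : linear transpose_fun.
Proof.
move=> a u v; apply/ffunP=> s; rewrite !ffunE scaler_sumr -big_split /=.
by apply: eq_bigr => t _; rewrite !ffunE mulrDl scalerAl.
Qed.

HB.instance Definition _ :=
  GRing.isLinear.Build R (perm_module R H2) (perm_module R H1) *:%R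
    transpose_fun transpose_is_linear.

(* The dual of phi, where v : R[S_2] is identified with the functional sending
   the basis element t to v t, and likewise for S_1. *)
Definition transpose : 'Hom(perm_module R H2, perm_module R H1) :=
  linfun transpose_fun.

Lemma transposeE (t : coset_sum H2) (s : coset_sum H1) :
  (transpose (perm_delta R t) : {ffun _ -> _}) s =
  (phi (perm_delta R s) : {ffun _ -> _}) t.
Proof.
rewrite lfunE /= ffunE (bigD1 t) //= ffunE eqxx mul1r big1 ?addr0 // => u ut.
by rewrite ffunE (negbTE ut) mul0r.
Qed.

End Transpose.

End PermutationModules.

(* L-valued R-bilinear pairings on 'cV[R]_n, for L an extension (via iota) of the
   fraction field of R: r in R acts on L as multiplication by iota r%:F. *)
Notation pairing iota n :=
  {bilinear 'cV_n -> 'cV_n -> _ | (iota \o @tofrac _) \; *%R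
                                & (iota \o @tofrac _) \; *%R}.

(* An R[G]-module that is free of rank n over R is a representation
   rG : mx_representation R G n; we use the column vectors 'cV[R]_n, on which
   g acts on the left by v |-> rG g *m v. *)
Section Representations.

Variable gT : finGroupType.
Local Notation G := [set: gT]%G.

Lemma dual_repr_subproof (R : comUnitRingType) (n : nat)
  (rG : mx_representation R G n) : mx_repr G (fun g => (rG g^-1%g)^T).
Proof.
split=> [|g h _ _]; first by rewrite invg1 repr_mx1 trmx1.
by rewrite invMg repr_mxM ?inE // trmx_mul.
Qed.

(* the module of linear functionals, in the dual basis *)
Definition dual_repr (R : comUnitRingType) (n : nat)
    (rG : mx_representation R G n) : mx_representation R G n :=
  MxRepresentation (dual_repr_subproof rG).

Definition self_dual (K : fieldType) (n : nat) (rG : mx_representation K G n) :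
    Prop :=
  mx_rsim rG (dual_repr rG).

Variables (R : idomainType) (n : nat) (rG : mx_representation R G n).

Definition repr_act (g : gT) (v : 'cV[R]_n) : 'cV[R]_n := rG g *m v.

Definition invariant_under (H : {group gT}) (v : 'cV[R]_n) : Prop :=
  forall h, h \in H -> repr_act h v = v.

Definition G_hom (m : nat) (H : 'I_m -> {group gT})
    (f : 'Hom(perm_module R H, 'cV[R]_n)) : Prop :=
  equivariant (@perm_act gT R m H) repr_act f.

Definition pullback (m1 m2 : nat) (H1 : 'I_m1 -> {group gT})
    (H2 : 'I_m2 -> {group gT})
    (psi : 'Hom(perm_module R H1, perm_module R H2))
    (f : 'Hom(perm_module R H2, 'cV[R]_n)) :
    'Hom(perm_module R H1, 'cV[R]_n) :=
  (f \o psi)%VF.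

Variables (L : fieldType) (iota : {rmorphism {fraction R} -> L}).

Definition G_invariant (B : 'cV[R]_n -> 'cV[R]_n -> L) : Prop :=
  forall g v w, B (repr_act g v) (repr_act g w) = B v w.

(* the extension of an R-bilinear B to Gamma (x)_R L *)
Definition extended_pairing (B : 'cV[R]_n -> 'cV[R]_n -> L) (v w : 'cV[L]_n) :
    L :=
  \sum_i \sum_j v i 0 * w j 0 * B (delta_mx i 0) (delta_mx j 0).

(* Both kernels of the L-linear extension of B vanish; for an L-valued pairing,
   vanishing of the kernels on Gamma itself would be too weak (Gram
   determinants could be zero). *)
Definition nondegenerate_pairing (B : 'cV[R]_n -> 'cV[R]_n -> L) : Prop :=
  (forall v, (forall w, extended_pairing B v w = 0) -> v = 0) /\
  (forall w, (forall v, extended_pairing B v w = 0) -> w = 0).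

(* det (1/|H| <,> | Gamma^H) computed in the family b *)
Definition scaled_gram_det (B : 'cV[R]_n -> 'cV[R]_n -> L) (H : {group gT})
    (d : nat) (b : 'I_d -> 'cV[R]_n) : L :=
  \det (\matrix_(k < d, l < d) (#|H|%:R^-1 * B (b k) (b l))).

(* x = y in L^* / (R^* )^2. Since x^-1 = 0 for x = 0, the condition x != 0
   also says that no numerator or denominator occurring in x or y vanishes. *)
Definition eq_mod_unit_squares (x y : L) : Prop :=
  x != 0 /\
  exists2 u : R, u \is a GRing.unit & x = iota (tofrac u) ^+ 2 * y.

End Representations.

(* Main.v *)
Require Import Defs.
From HB Require Import structures.
From mathcomp Require Import all_boot all_order all_algebra all_fingroup.
From mathcomp Require Import mxrepresentation sesquilinear.

Set Implicit Arguments.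
Unset Strict Implicit.
Unset Printing Implicit Defensive.

Import GRing.Theory.
Local Open Scope ring_scope.

(** The theorem compares two adjoint operators.  For S = S_1 or S_2 put on
    Hom_G(R[S], Gamma) the bilinear form

      (f, g)_S = 1/|G| * sum over s in S of <f s, g s>          (hom_form).

    Writing both sides as a double sum over S_1 x S_2 of an entry of phi times
    a value of the pairing shows (f o phi, g)_{S_1} = (f, g o phi^tr)_{S_2}
    (hom_form_transpose).  In bases f1 and f2 with Gram matrices G1 and G2 this
    reads M^T G1 = G2 M_tr, so det M * det G1 = det G2 * det M_tr, and the
    ratio det M_tr / det M is det G1 / det G2 once these are nonzero.

    The Gram determinants are computed in another basis.  An equivariant map on
    R[G/H] is determined by the image of the coset H, which may be any
    H-invariant vector, so Hom_G(R[S], Gamma) is the direct sum of the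
    Gamma^{H_i}, and their bases concatenate to a basis of it (concat_basisP).
    As G/H_i has |G|/|H_i| elements and the pairing is G-invariant, (f, g)_S
    becomes the orthogonal sum of the forms 1/|H_i| <,> (hom_form_base): the Gram matrix in
    the concatenated basis is block diagonal (det_gram_concat_basis).  Changing
    the basis multiplies a Gram determinant by the square of the determinant of
    an invertible matrix over R (gram_det_basis), which is the ambiguity
    allowed in the statement.

    It remains to see that nothing vanishes.  The pairing restricted to Gamma^H
    stays nondegenerate because summing over H projects Gamma onto Gamma^H up
    to the factor |H|, which is invertible in L (gram_invariants_neq0).
    Precomposition with phi^tr is injective when phi is: the coordinates of
    f o phi^tr are the coordinates of phi applied to the coordinate vectors of
    f (pullback_transpose_eq0).  So det M_tr is nonzero, and then det M is
    nonzero by the determinant identity. *)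

(** * Block diagonal determinants *)

Lemma det_castmx (A : comNzRingType) p q (e : p = q) (X : 'M[A]_p) :
  \det (castmx (e, e) X) = \det X.
Proof. by case: q / e; rewrite castmx_id. Qed.

Lemma det_mxdiag (A : comNzRingType) m (d : 'I_m -> nat)
    (D : forall i, 'M[A]_(d i)) :
  \det (\mxdiag_i D i) = \prod_i \det (D i).
Proof.
elim: m => [|m IHm] in d D *; last first.
  by rewrite mxdiag_recl det_castmx det_ublock IHm big_ord_recl.
rewrite [RHS]big_ord0; move: (\mxdiag_i D i).
have: (\sum_i d i = 0)%N by rewrite big_ord0.
by move: (\sum_i d i)%N => k -> X; rewrite det_mx00.
Qed.

(** * Bases of submodules and Gram matrices *)

Section Bases.

Variables (R : comNzRingType) (V : lmodType R) (P : V -> Prop).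

Lemma basis_inj r (b : 'I_r -> V) (x y : 'rV[R]_r) :
  is_basis P b -> P (\sum_k x 0 k *: b k) ->
  \sum_k x 0 k *: b k = \sum_k y 0 k *: b k -> x = y.
Proof.
by move=> [_ Pb] Px exy; have [z [_ uz]] := Pb _ Px; rewrite -(uz x) // -(uz y).
Qed.

Lemma basis_coords r (b : 'I_r -> V) q (v : 'I_q -> V) :
  is_basis P b -> (forall k, P (v k)) ->
  exists A : 'M[R]_(q, r), forall k, v k = \sum_l A k l *: b l.
Proof.
move=> [_ Pb] Pv.
have /fin_all_exists[a aP] k : exists x : 'rV[R]_r, v k = \sum_l x 0 l *: b l.
  by have [x [xP _]] := Pb _ (Pv k); exists x.
exists (\matrix_k a k) => k; rewrite aP.
by apply: eq_bigr => l _; rewrite mxE.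
Qed.

(** Substituting one expansion into the other expands b in itself with matrix
    A *m A', and expansions in a basis are unique. *)
Lemma basis_mulmx r (b : 'I_r -> V) q (v : 'I_q -> V) (A : 'M[R]_(r, q))
    (A' : 'M[R]_(q, r)) : is_basis P b ->
  (forall k, b k = \sum_l A k l *: v l) ->
  (forall k, v k = \sum_l A' k l *: b l) -> A *m A' = 1%:M.
Proof.
move=> bP bA vA'; apply/row_matrixP => k.
have E : \sum_l (row k 1%:M : 'rV[R]_r) 0 l *: b l = b k.
  rewrite (bigD1 k) //= big1 => [|l lk]; rewrite !mxE ?eqxx ?scale1r ?addr0 //.
  by rewrite eq_sym (negPf lk) scale0r.
apply/esym/(basis_inj bP); rewrite E; first by case: bP.
rewrite [LHS]bA (eq_bigr _ (fun l _ => congr1 _ (vA' l))).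
under eq_bigr do rewrite scaler_sumr; rewrite exchange_big /=.
apply: eq_bigr => l _; rewrite !mxE scaler_suml.
by apply: eq_bigr => j _; rewrite scalerA.
Qed.

End Bases.

Definition gram (L V : Type) (beta : V -> V -> L) d (b : 'I_d -> V) :=
  \matrix_(k, l) beta (b k) (b l).

(** A pairing with values in an extension L of R is linear over the embedding
    sigma of R into L. *)
Notation form sigma V := {bilinear V -> V -> _ | sigma \; *%R & sigma \; *%R}.

Section Gram.

Variables (R L : comUnitRingType) (sigma : {rmorphism R -> L}) (V : lmodType R).
Variable beta : form sigma V.

Lemma form_suml (I : finType) (a : I -> R) (u : I -> V) v :
  beta (\sum_k a k *: u k) v = \sum_k sigma (a k) * beta (u k) v.
Proof. by rewrite linear_sumlz; apply: eq_bigr => k _; rewrite linearZl_LR. Qed.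

Lemma form_sumr (I : finType) (a : I -> R) (u : I -> V) v :
  beta v (\sum_k a k *: u k) = \sum_k sigma (a k) * beta v (u k).
Proof. by rewrite linear_sumr; apply: eq_bigr => k _; rewrite linearZr_LR. Qed.

Lemma gram_lincomb d q (b : 'I_d -> V) (v : 'I_q -> V) (A : 'M[R]_(q, d)) :
    (forall k, v k = \sum_l A k l *: b l) ->
  gram beta v = map_mx sigma A *m gram beta b *m (map_mx sigma A)^T.
Proof.
move=> vA; apply/matrixP=> k l; rewrite !mxE !vA form_sumr.
apply: eq_bigr => j _; rewrite form_suml !mxE mulrC; congr (_ * _).
by apply: eq_bigr => i _; rewrite !mxE.
Qed.

(** Each basis expands in the other, so the base change matrix A is invertible
    over R: hence r = q, and det A is a unit.  The Gram matrix of b is that of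
    c multiplied by A on the left and by A^T on the right. *)
Lemma gram_det_basis (P : V -> Prop) r q (b : 'I_r -> V) (c : 'I_q -> V) :
  is_basis P b -> is_basis P c ->
  exists2 u, u \is a GRing.unit &
    \det (gram beta b) = sigma u ^+ 2 * \det (gram beta c).
Proof.
move=> bP cP.
have [A bA] := basis_coords cP bP.1; have [A' cA'] := basis_coords bP cP.1.
have AA' := basis_mulmx bP bA cA'; have A'A := basis_mulmx cP cA' bA.
have /eqP e : r == q by rewrite eqn_leq (mulmx1_min AA') (mulmx1_min A'A).
move: A A' AA' A'A bA cA'; case: q / e c cP => c _ A A' AA' _ bA _.
exists (\det A).
  by apply/unitrPr; exists (\det A'); rewrite -det_mulmx AA' det1.
rewrite (gram_lincomb bA) !det_mulmx det_tr det_map_mx mulrAC expr2.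
by rewrite mulrC mulrA.
Qed.

End Gram.

(** * The pairing on the invariants of a subgroup *)

Section Invariants.

Variables (gT : finGroupType) (R : idomainType) (n : nat).
Variable Gamma : mx_representation R [set: gT] n.
Variables (L : fieldType) (sigma : {rmorphism R -> L}).
Variable B : form sigma 'cV[R]_n.

Definition form_mx : 'M[L]_n := gram B (fun k => delta_mx k 0).

Lemma form_mxE (u v : 'cV[R]_n) :
  B u v = ((map_mx sigma u)^T *m form_mx *m map_mx sigma v) 0 0.
Proof.
have span (w : 'cV[R]_n) : w = \sum_k w k 0 *: delta_mx k 0.
  by rewrite [LHS]matrix_sum_delta; apply: eq_bigr => k _; rewrite big_ord1.
rewrite {1}[v]span form_sumr !mxE; apply: eq_bigr => l _.
rewrite {1}[u]span form_suml !mxE mulrC; congr (_ * _).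
by apply: eq_bigr => k _; rewrite !mxE.
Qed.

(** A row killed by the matrix of B is a vector in the left kernel of the
    L-linear extension of B. *)
Lemma form_mx_unit : nondegenerate_pairing B -> form_mx \in unitmx.
Proof.
move=> [ndB _]; rewrite unitmxE unitfE; apply/negP => /det0P[v v0 vB].
case/eqP: v0; rewrite -[v]trmxK (ndB v^T) ?trmx0 // => w.
rewrite /extended_pairing exchange_big big1 //= => j _.
have /rowP/(_ j) := vB; rewrite !mxE => vBj.
rewrite (eq_bigr (fun i => w j 0 * (v 0 i * form_mx i j))); last first.
  by move=> i _; rewrite !mxE mulrCA mulrA.
by rewrite -mulr_sumr vBj mulr0.
Qed.

Lemma gram_mx d (b : 'I_d -> 'cV[R]_n) :
  let P := map_mx sigma (\matrix_(i, k) b k i 0) in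
  gram B b = P^T *m form_mx *m P.
Proof.
move=> P; apply/matrixP => k l.
have colP j : map_mx sigma (b j) = col j P by apply/colP => i; rewrite !mxE.
rewrite mxE form_mxE !colP tr_col -row_mul !mxE.
by apply: eq_bigr => j _; rewrite !mxE.
Qed.

Hypothesis B_inv : G_invariant Gamma B.

Lemma form_mx_adjoint g :
  form_mx *m map_mx sigma (Gamma g) =
  (map_mx sigma (Gamma g^-1%g))^T *m form_mx.
Proof.
apply/matrixP => i j.
have entry (X : 'M[L]_n) k l :
      ((delta_mx k 0 : 'cV_n)^T *m X *m (delta_mx l 0 : 'cV_n)) 0 0 = X k l.
  by rewrite trmx_delta -rowE -colE !mxE.
transitivity (B (delta_mx i 0) (Gamma g *m delta_mx j 0)).
  rewrite form_mxE map_mxM !map_delta_mx !mulmxA.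
  by rewrite -[_ *m _ *m map_mx _ _]mulmxA entry.
rewrite -(B_inv g^-1%g) /repr_act mulmxA -repr_mxM ?inE // mulVg repr_mx1 mul1mx.
rewrite form_mxE map_mxM !map_delta_mx trmx_mul -mulmxA mulmxA.
by rewrite -[_ *m _ *m form_mx]mulmxA entry.
Qed.

(** Let N be the sum of the h in H acting on Gamma, P the matrix with columns
    b, and F the matrix of B.  The columns of N are invariant, so N = P C^T for
    some C; since N acts on invariants as |H|, also C^T P = |H|.  As N is
    self-adjoint for F, the Gram matrix P^T F P multiplied by C^T F^-1 C is
    P^T F N F^-1 C = P^T N^T C = |H| P^T C = |H|^2. *)
Lemma gram_invariants_neq0 (H : {group gT}) d (b : 'I_d -> 'cV[R]_n) :
  nondegenerate_pairing B -> #|H|%:R != 0 :> L ->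
  is_basis (invariant_under Gamma H) b -> \det (gram B b) != 0.
Proof.
move=> ndB cH bP.
pose norm : 'M[R]_n := \sum_(h in H) Gamma h.
have norm_inv k : invariant_under Gamma H (col k norm).
  move=> g gH; rewrite /repr_act !colE mulmxA mulmx_sumr; congr (_ *m _).
  rewrite [RHS](reindex_inj (mulgI g)) /=.
  apply: eq_big => [h|h hH]; first by rewrite groupMl.
  by rewrite repr_mxM ?inE.
have [C normC] := basis_coords bP norm_inv.
pose P : 'M[R]_(n, d) := \matrix_(i, k) b k i 0.
have PE k : col k P = b k by apply/colP => i; rewrite !mxE.
have PC : norm = P *m C^T.
  apply/matrixP => i k; have /colP/(_ i) := normC k.
  rewrite !mxE => ->; rewrite summxE.
  by apply: eq_bigr => l _; rewrite !mxE mulrC.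
have normP : norm *m P = #|H|%:R *: P.
  apply/matrixP => i k.
  have /colP/(_ i) : col k (norm *m P) = #|H|%:R *: b k; last by rewrite !mxE.
  rewrite colE -mulmxA -colE PE mulmx_suml scaler_nat -sumr_const.
  by apply: eq_bigr => h hH; rewrite [LHS](bP.1 k).
have CP : C^T *m P = #|H|%:R%:M.
  apply/trmx_inj/row_matrixP => k.
  have E (X : 'M[R]_d) :
      \sum_l (row k X^T) 0 l *: b l = col k (P *m X).
    apply/colP => i; rewrite !mxE summxE.
    by apply: eq_bigr => l _; rewrite !mxE mulrC.
  apply: (basis_inj bP); rewrite !E mulmxA -PC normP.
    have -> : col k (#|H|%:R *: P) = #|H|%:R *: b k by rewrite linearZ /= PE.
    by move=> h hH; rewrite /repr_act -scalemxAr [X in _ *: X](bP.1 k).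
  by rewrite mul_mx_scalar.
have adj : form_mx *m map_mx sigma norm = (map_mx sigma norm)^T *m form_mx.
  rewrite (raddf_sum (map_mx sigma)) /= mulmx_sumr raddf_sum mulmx_suml.
  rewrite [RHS](reindex_inj invg_inj) /=; apply: eq_big => h.
    by rewrite groupV.
  by move=> _; exact: form_mx_adjoint.
pose D := map_mx sigma C.
suff E : gram B b *m (D^T *m invmx form_mx *m D) = (#|H|%:R ^+ 2)%:M.
  have /eqP := congr1 determinant E; rewrite det_mulmx det_scalar.
  apply: contraL => /eqP ->; rewrite mul0r eq_sym !expf_eq0 (negPf cH).
  by rewrite !andbF.
rewrite gram_mx -/P !mulmxA -[_ *m D^T]mulmxA [D^T]map_trmx -map_mxM /= -PC.
rewrite -[_ *m map_mx _ norm]mulmxA adj -!mulmxA mulKVmx ?form_mx_unit //.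
rewrite mulmxA -trmx_mul -map_mxM normP -[D]trmxK -trmx_mul.
rewrite [D^T]map_trmx -map_mxM /=.
rewrite -scalemxAr CP map_mxZ map_scalar_mx linearZ /= tr_scalar_mx.
by rewrite rmorph_nat scale_scalar_mx.
Qed.

End Invariants.

(** * Equivariant maps out of a permutation module *)

Section PermutationModules.

Variables (gT : finGroupType) (R : idomainType).
Variables (m : nat) (H : 'I_m -> {group gT}).

Local Notation S := (coset_sum H).
Local Notation RS := (perm_module R H).
Local Notation act := (@coset_sum_act gT m H).
Local Notation delta := (@perm_delta gT R m H).

Lemma perm_delta_sum (v : RS) : v = \sum_s (v : {ffun _ -> _}) s *: delta s.
Proof.
apply/ffunP => t; rewrite sum_ffunE (bigD1 t) //= big1 => [|s st].
  by rewrite !ffunE eqxx addr0 [_ *: _]mulr1.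
by rewrite !ffunE eq_sym (negPf st) scaler0.
Qed.

Lemma hom_ext (W : vectType R) (f g : 'Hom(RS, W)) :
  (forall s, f (delta s) = g (delta s)) -> f = g.
Proof.
move=> fg; apply/lfunP => v; rewrite [v]perm_delta_sum !linear_sum.
by apply: eq_bigr => s _; rewrite !linearZ /= fg.
Qed.

Section HomOfFun.

Variables (W : vectType R) (F : S -> W).

Definition hom_of_fun (v : RS) : W := \sum_s (v : {ffun _ -> _}) s *: F s.

Lemma hom_of_fun_is_linear : linear hom_of_fun.
Proof.
move=> a u v; rewrite /hom_of_fun scaler_sumr -big_split /=.
by apply: eq_bigr => s _; rewrite !ffunE scalerDl scalerA.
Qed.

HB.instance Definition _ :=
  GRing.isLinear.Build R RS W *:%R hom_of_fun hom_of_fun_is_linear.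

Lemma hom_of_funE s : linfun hom_of_fun (delta s) = F s.
Proof.
rewrite lfunE /= /hom_of_fun (bigD1 s) //= big1 => [|t ts].
  by rewrite ffunE eqxx scale1r addr0.
by rewrite ffunE (negPf ts) scale0r.
Qed.

End HomOfFun.

Lemma coset_sum_actK g : cancel (act g) (act g^-1%g).
Proof.
case=> i [C CH]; congr Tagged; apply: val_inj => /=.
by rewrite -lcosetM mulVg mul1g.
Qed.

Lemma perm_act_delta g s : perm_act g (delta s) = delta (act g s).
Proof.
apply/ffunP => t; rewrite !ffunE; congr (_%:R).
rewrite -(inj_eq (can_inj (coset_sum_actK g))).
by rewrite -{1}[g]invgK coset_sum_actK.
Qed.

Lemma base_coset_subproof i : (H i : {set gT}) \in lcosets (H i) [set: gT].
Proof. by apply/lcosetsP; exists 1%g; rewrite ?lcoset1. Qed.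

Definition base_coset i : S :=
  Tagged (fun i => cosets (H i))
         (Sub (H i : {set gT}) (base_coset_subproof i) : cosets (H i)).

Definition coset_rep (s : S) : gT := repr (val (tagged s)).

(** Every element of the disjoint union of the G/H_i is a translate of the coset
    H_i in its own summand; this is why an equivariant map is determined by
    its values at the base cosets. *)
Lemma act_coset_rep s : act (coset_rep s) (base_coset (tag s)) = s.
Proof.
case: s => i [C CH]; congr Tagged; apply: val_inj => /=.
rewrite /coset_rep /=; have /lcosetsP[x _ eC] := CH.
have : repr C \in C by apply: (@mem_repr _ _ x); rewrite eC lcoset_refl.
by move: (repr C) => y; rewrite eC => /lcoset_eqP.
Qed.

Lemma act_base g i : g \in H i -> act g (base_coset i) = base_coset i.
Proof. by move=> gH; congr Tagged; apply: val_inj; rewrite /= lcoset_id. Qed.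

(** The chosen representatives are not equivariant, but the defect lies in the
    stabiliser H_i, which acts trivially on the vectors of interest. *)
Lemma coset_rep_act g s :
  exists2 h, h \in H (tag s) & coset_rep (act g s) = (g * coset_rep s * h)%g.
Proof.
set x := coset_rep (act g s); set y := coset_rep s.
have e : act x (base_coset (tag s)) = act g (act y (base_coset (tag s))).
  transitivity (act g s); first exact: (act_coset_rep (act g s)).
  by rewrite -[in LHS](act_coset_rep s).
have {e} := congr1 (fun t : S => val (tagged t)) e; rewrite /= => e.
exists ((g * y)^-1 * x)%g; last by rewrite mulKVg.
by rewrite -mem_lcoset lcosetM -e lcoset_refl.
Qed.

Variables (n : nat) (Gamma : mx_representation R [set: gT] n).
Local Notation V := ('Hom(RS, 'cV[R]_n)).

Lemma G_homP (f : V) :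
  G_hom Gamma f <-> forall g s, f (delta (act g s)) = Gamma g *m f (delta s).
Proof.
split=> [fG g s|fG g v]; first by rewrite -perm_act_delta fG.
rewrite [perm_act g v]perm_delta_sum [in RHS](perm_delta_sum v) /repr_act.
rewrite (reindex_inj (can_inj (coset_sum_actK g))) !linear_sum.
apply: eq_bigr => s _; rewrite ffunE coset_sum_actK.
by rewrite !linearZ /= fG.
Qed.

Lemma hom_base_invariant (f : V) i :
  G_hom Gamma f -> invariant_under Gamma (H i) (f (delta (base_coset i))).
Proof. by move=> /G_homP fG h hH; rewrite /repr_act -fG act_base. Qed.

Lemma G_hom_ext (f g : V) : G_hom Gamma f -> G_hom Gamma g ->
  (forall i, f (delta (base_coset i)) = g (delta (base_coset i))) -> f = g.
Proof.
move=> /G_homP fG /G_homP gG fg; apply: hom_ext => s.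
by rewrite -(act_coset_rep s) fG gG fg.
Qed.

Lemma G_hom_lincomb d (x : 'rV[R]_d) (f : 'I_d -> V) :
  (forall k, G_hom Gamma (f k)) -> G_hom Gamma (\sum_k x 0 k *: f k).
Proof.
move=> fG; apply/G_homP => g s; rewrite !sum_lfunE mulmx_sumr.
apply: eq_bigr => k _; rewrite !scale_lfunE -scalemxAr; congr (_ *: _).
exact: ((G_homP _).1 (fG k)).
Qed.

Definition hom_of_invariants (v : 'I_m -> 'cV[R]_n) : V :=
  linfun (hom_of_fun (fun s => Gamma (coset_rep s) *m v (tag s))).

(** The inverse of the restriction of equivariant maps to the base cosets: the
    choice of the representatives is immaterial on invariant vectors. *)
Lemma hom_of_invariantsP (v : 'I_m -> 'cV[R]_n) :
  (forall i, invariant_under Gamma (H i) (v i)) ->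
  G_hom Gamma (hom_of_invariants v) /\
  (forall i, hom_of_invariants v (delta (base_coset i)) = v i).
Proof.
move=> vH; split=> [|i].
  apply/G_homP => g s; rewrite !hom_of_funE.
  have [h hH ->] := coset_rep_act g s.
  by rewrite !repr_mxM ?inE // -!mulmxA [X in _ *m (_ *m X)](vH (tag s)).
rewrite hom_of_funE /=; apply: vH; rewrite /coset_rep /=.
exact: (mem_repr _ (group1 (H i))).
Qed.

Section ConcatenatedBasis.

Variables (d : 'I_m -> nat) (b : forall i, 'I_(d i) -> 'cV[R]_n).
Arguments b : clear implicits.
Hypothesis b_basis : forall i, is_basis (invariant_under Gamma (H i)) (b i).

(** The k-th map is supported on one summand G/H_i, where it sends H_i to one
    vector of the basis b i.  Selecting this vector by a sum over all
    positions of rank k avoids a cast between the types 'I_(d i). *)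
Definition concat_basis (k : 'I_(\sum_i d i)) : V :=
  hom_of_invariants (fun i => \sum_(l < d i | tagnat.Rank i l == k) b i l).

Lemma concat_basis_G_hom k :
  G_hom Gamma (concat_basis k) /\
  (forall i, concat_basis k (delta (base_coset i)) =
             \sum_(l < d i | tagnat.Rank i l == k) b i l).
Proof.
apply: hom_of_invariantsP => i h hH; rewrite /repr_act mulmx_sumr.
by apply: eq_bigr => l _; apply: (b_basis i).1.
Qed.

Lemma concat_basis_Rank i (l : 'I_(d i)) :
  concat_basis (tagnat.Rank i l) (delta (base_coset i)) = b i l.
Proof.
rewrite (concat_basis_G_hom _).2; apply: big_pred1 => l'.
by rewrite -val_eqE tagnat.eq_Rank eqxx.
Qed.

Lemma concat_basis_Rank_neq i (l : 'I_(d i)) j : j != i ->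
  concat_basis (tagnat.Rank i l) (delta (base_coset j)) = 0.
Proof.
move=> /negPf ij; rewrite (concat_basis_G_hom _).2; apply: big_pred0 => l'.
by rewrite -val_eqE tagnat.eq_Rank ij.
Qed.

Lemma concat_basis_lincomb (x : 'rV[R]_(\sum_i d i)) i :
  (\sum_k x 0 k *: concat_basis k) (delta (base_coset i)) =
  \sum_(l < d i) x 0 (tagnat.Rank i l) *: b i l.
Proof.
rewrite sum_lfunE.
pose t k (l : 'I_(d i)) := if tagnat.Rank i l == k then x 0 k *: b i l else 0.
transitivity (\sum_k \sum_l t k l).
  apply: eq_bigr => k _; rewrite scale_lfunE (concat_basis_G_hom _).2.
  by rewrite scaler_sumr [LHS]big_mkcond.
rewrite [LHS]exchange_big; apply: eq_bigr => l _ /=; rewrite -[LHS]big_mkcond.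
by rewrite [LHS](big_pred1 (tagnat.Rank i l)) // => k; rewrite eq_sym.
Qed.

(** At the base coset of summand i only the coordinates of rank (i, l) are seen,
    so the coordinates of f are those of its values at the base cosets. *)
Lemma concat_basisP : is_basis (G_hom Gamma (H := H)) concat_basis.
Proof.
split=> [k|f fG]; first exact: (concat_basis_G_hom k).1.
have /fin_all_exists[x xP] i : exists x : 'rV[R]_(d i),
    f (delta (base_coset i)) = \sum_l x 0 l *: b i l.
  have [x [xP _]] := (b_basis i).2 _ (hom_base_invariant (i := i) fG).
  by exists x.
exists (\mxrow_i x i); split=> [|y fy].
  apply: G_hom_ext => // [|i].
    by apply: G_hom_lincomb => k; exact: (concat_basis_G_hom k).1.
  rewrite concat_basis_lincomb xP; apply: eq_bigr => l _; congr (_ *: _).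
  by have /rowP/(_ l) := mxrowK x i; rewrite mxE.
apply/esym/mxrowP => i; rewrite mxrowK; apply/esym.
have e : f (delta (base_coset i)) = \sum_l submxrow y i 0 l *: b i l.
  rewrite fy concat_basis_lincomb.
  by apply: eq_bigr => l _; rewrite mxE.
apply: (basis_inj (b_basis i)); rewrite -xP //.
exact: hom_base_invariant.
Qed.

End ConcatenatedBasis.

Section Pairing.

Variables (L : fieldType) (sigma : {rmorphism R -> L}).
Variable B : form sigma 'cV[R]_n.

(** With the factor 1/|G| the orbit G/H_i contributes 1/|H_i| <,>. *)
Definition hom_form (f g : V) : L :=
  #|gT|%:R^-1 * \sum_s B (f (delta s)) (g (delta s)).

Lemma hom_form_bilinear :
  bilinear_for (GRing.Scale.Law.clone _ _ (sigma \; *%R) _)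
    (GRing.Scale.Law.clone _ _ (sigma \; *%R) _) hom_form.
Proof.
split=> [w|w] a u v; rewrite /hom_form /= [X in _ = X + _]mulrCA -mulrDr;
  rewrite [X in _ = _ * (X + _)]mulr_sumr -big_split /=;
  congr (_ * _); apply: eq_bigr => s _.
  by rewrite add_lfunE scale_lfunE linearPl.
by rewrite add_lfunE scale_lfunE linearPr.
Qed.

HB.instance Definition _ :=
  bilinear_isBilinear.Build R V V L _ _ hom_form hom_form_bilinear.

Lemma card_cosets i : (#|cosets (H i)| * #|H i| = #|gT|)%N.
Proof.
by rewrite card_sig card_lcosets mulnC Lagrange ?subsetT // cardsT.
Qed.

Hypothesis B_inv : G_invariant Gamma B.
Hypothesis cG : #|gT|%:R != 0 :> L.

(** By invariance the summand is constant on each orbit G/H_i, and this orbit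
    has |G|/|H_i| elements. *)
Lemma hom_form_base f g : G_hom Gamma f -> G_hom Gamma g ->
  hom_form f g = \sum_i #|H i|%:R^-1 *
                   B (f (delta (base_coset i))) (g (delta (base_coset i))).
Proof.
move=> /G_homP fG /G_homP gG; rewrite /hom_form.
pose c (s : S) :=
  B (f (delta (base_coset (tag s)))) (g (delta (base_coset (tag s)))).
rewrite (eq_bigr c) => [|s _]; last first.
  by rewrite -{1 2}(act_coset_rep s) fG gG; apply: B_inv.
rewrite -(sig_big_dep (J := fun i => cosets (H i)) xpredT (fun=> xpredT)
  (fun i _ => B (f (delta (base_coset i))) (g (delta (base_coset i))))) /=.
rewrite mulr_sumr; apply: eq_bigr => i _.
rewrite sumr_const -[X in _ * X]mulr_natl mulrA; congr (_ * _).
move: cG; rewrite -(card_cosets i) natrM mulf_eq0 negb_or => /andP[c0 h0].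
by rewrite invfM mulrAC mulVf // mul1r.
Qed.

Section InBases.

Variables (d : 'I_m -> nat) (b : forall i, 'I_(d i) -> 'cV[R]_n).
Hypothesis b_basis : forall i, is_basis (invariant_under Gamma (H i)) (@b i).

(** Basis maps supported on different summands are orthogonal. *)
Lemma det_gram_concat_basis :
  \det (gram hom_form (concat_basis b)) =
  \prod_i scaled_gram_det B (H i) (@b i).
Proof.
rewrite -det_mxdiag; congr (\det _); apply/mxblockP => i j.
apply/matrixP => k l; rewrite mxblockK !mxE.
have concatG k' := (concat_basis_G_hom b_basis k').1.
rewrite hom_form_base // (bigD1 i) //= big1 => [|i' ii']; last first.
  by rewrite concat_basis_Rank_neq // linear0l mulr0.
rewrite concat_basis_Rank // addr0; case: eqVneq l => [<- l|ij l].
  by rewrite concat_basis_Rank // conform_mx_id mxE.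
by rewrite concat_basis_Rank_neq // linear0r mulr0 mxE.
Qed.

Lemma det_gram_hom_form r (f : 'I_r -> V) :
  is_basis (G_hom Gamma (H := H)) f ->
  exists2 u, u \is a GRing.unit & \det (gram hom_form f) =
    sigma u ^+ 2 * \prod_i scaled_gram_det B (H i) (@b i).
Proof.
move=> fP; rewrite -det_gram_concat_basis.
exact: gram_det_basis fP (concat_basisP b_basis).
Qed.

Lemma scaled_gram_det_neq0 i : nondegenerate_pairing B ->
  scaled_gram_det B (H i) (@b i) != 0.
Proof.
move=> ndB.
have h0 : #|H i|%:R != 0 :> L.
  move: cG; rewrite -(card_cosets i) natrM mulf_eq0 negb_or.
  by case/andP.
have -> : scaled_gram_det B (H i) (@b i) =
          \det (#|H i|%:R^-1 *: gram B (@b i)).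
  by congr (\det _); apply/matrixP => k l; rewrite !mxE.
rewrite detZ mulf_neq0 ?expf_neq0 ?invr_eq0 //.
exact: gram_invariants_neq0 (b_basis i).
Qed.

End InBases.

End Pairing.

End PermutationModules.

(** * Adjointness of phi and its transpose *)

Section Transpose.

Variables (gT : finGroupType) (R : idomainType) (m1 m2 : nat).
Variables (H1 : 'I_m1 -> {group gT}) (H2 : 'I_m2 -> {group gT}).
Variable phi : 'Hom(perm_module R H1, perm_module R H2).
Variable n : nat.

Lemma pullbackE (m m' : nat) (H : 'I_m -> {group gT}) (H' : 'I_m' -> {group gT})
    (psi : 'Hom(perm_module R H, perm_module R H'))
    (f : 'Hom(perm_module R H', 'cV[R]_n)) s :
  pullback psi f (perm_delta R s) =
  \sum_t (psi (perm_delta R s) : {ffun _ -> _}) t *: f (perm_delta R t).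
Proof.
rewrite comp_lfunE {1}[psi _]perm_delta_sum linear_sum.
by apply: eq_bigr => t _; rewrite linearZ.
Qed.

(** Fix a coordinate i of Gamma.  The vector w of the i-th coordinates of the
    f s, for s in S_1, satisfies (phi w) t = (f (phi^tr t)) i = 0 for all t, so
    w = 0 by injectivity of phi. *)
Lemma pullback_transpose_eq0 (f : 'Hom(perm_module R H1, 'cV[R]_n)) :
  injective phi -> pullback (transpose phi) f = 0 -> f = 0.
Proof.
move=> phi_inj f0; apply: hom_ext => s; rewrite zero_lfunE.
apply/colP => i; rewrite mxE.
pose w : perm_module R H1 := [ffun s => f (perm_delta R s) i 0].
suff /ffunP/(_ s) : w = 0 by rewrite !ffunE.
apply: phi_inj; rewrite linear0; apply/ffunP => t; rewrite ffunE.
transitivity (pullback (transpose phi) f (perm_delta R t) i 0); last first.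
  by rewrite f0 zero_lfunE mxE.
rewrite pullbackE summxE [w]perm_delta_sum linear_sum sum_ffunE.
apply: eq_bigr => s' _.
by rewrite linearZ /= !ffunE mxE transposeE [LHS]mulrC.
Qed.

Variables (L : fieldType) (sigma : {rmorphism R -> L}).
Variable B : form sigma 'cV[R]_n.

(** Both sides are 1/|G| times the sum of phi_ts <f2 t, f1 s> over all s and t,
    where phi_ts is an entry of the matrix of phi. *)
Lemma hom_form_transpose f1 f2 :
  hom_form B (pullback phi f2) f1 = hom_form B f2 (pullback (transpose phi) f1).
Proof.
congr (_ * _).
pose c s t := sigma ((phi (perm_delta R s) : {ffun _ -> _}) t) *
              B (f2 (perm_delta R t)) (f1 (perm_delta R s)).
transitivity (\sum_s \sum_t c s t).
  by apply: eq_bigr => s _; rewrite pullbackE form_suml.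
rewrite exchange_big; apply: eq_bigr => t _; rewrite pullbackE form_sumr.
by apply: eq_bigr => s _; rewrite transposeE.
Qed.

End Transpose.

(** * The comparison of determinants *)

Theorem theorem3p2
  (gT : finGroupType)
  (R : idomainType) (R_pid : principal_ideal_domain R) (R_int : contains_int R)
  (m1 m2 : nat) (H1 : 'I_m1 -> {group gT}) (H2 : 'I_m2 -> {group gT})
  (Theta_rel : is_relation rat H1 H2 \/
               exists2 p : nat, prime p & is_relation (Zloc p) H1 H2)
  (n : nat) (Gamma : mx_representation R [set: gT] n)
  (Gamma_self_dual : self_dual (map_repr (@tofrac R) Gamma))
  (phi : 'Hom(perm_module R H1, perm_module R H2))
  (phi_G : equivariant (@perm_act gT R m1 H1) (@perm_act gT R m2 H2) phi)
  (phi_inj : injective phi)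
  (L : fieldType) (iota : {rmorphism {fraction R} -> L})
  (B : pairing iota n) (B_inv : G_invariant Gamma B)
  (B_nondeg : nondegenerate_pairing B)
  (* R-bases of Hom_{R[G]}(R[S_1], Gamma) and Hom_{R[G]}(R[S_2], Gamma) *)
  (r : nat)
  (f1 : 'I_r -> 'Hom(perm_module R H1, 'cV[R]_n))
  (f2 : 'I_r -> 'Hom(perm_module R H2, 'cV[R]_n))
  (f1_basis : is_basis (G_hom Gamma (H := H1)) f1)
  (f2_basis : is_basis (G_hom Gamma (H := H2)) f2)
  (M M_tr : 'M[R]_r)
  (M_phi : is_matrix_of (pullback phi) f2 f1 M)
  (M_phi_tr : is_matrix_of (pullback (transpose phi)) f1 f2 M_tr)
  (* R-bases of the fixed submodules *)
  (d1 : 'I_m1 -> nat) (b1 : forall i, 'I_(d1 i) -> 'cV[R]_n)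
  (b1_basis : forall i, is_basis (invariant_under Gamma (H1 i)) (@b1 i))
  (d2 : 'I_m2 -> nat) (b2 : forall j, 'I_(d2 j) -> 'cV[R]_n)
  (b2_basis : forall j, is_basis (invariant_under Gamma (H2 j)) (@b2 j)) :
  eq_mod_unit_squares iota
    (iota (tofrac (\det M_tr) / tofrac (\det M)))
    ((\prod_i scaled_gram_det B (H1 i) (@b1 i)) /
     (\prod_j scaled_gram_det B (H2 j) (@b2 j))).
Proof.
pose sigma : {rmorphism R -> L} := iota \o @tofrac R.
have sigma_eq0 x : (sigma x == 0) = (x == 0).
  by rewrite /= fmorph_eq0 tofrac_eq0.
have cG : #|gT|%:R != 0 :> L.
  rewrite -(rmorph_nat sigma) sigma_eq0; apply/eqP => c0.
  have /eqP := R_int #|gT| 0 c0; rewrite eqz_nat -cardsT => /eqP c0'.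
  by have := cardG_gt0 [set: gT]; rewrite c0'.
pose beta1 : form sigma _ := hom_form (H := H1) (B : form sigma _).
pose beta2 : form sigma _ := hom_form (H := H2) (B : form sigma _).
have [u1 u1U G1] :=
  det_gram_hom_form (sigma := sigma) B_inv cG b1_basis f1_basis.
have [u2 u2U G2] :=
  det_gram_hom_form (sigma := sigma) B_inv cG b2_basis f2_basis.
have nz2 : \prod_j scaled_gram_det B (H2 j) (@b2 j) != 0.
  by apply/prodf_neq0 => i _; exact: (scaled_gram_det_neq0 (sigma := sigma)).
have sigmaU u : u \is a GRing.unit -> sigma u != 0.
  by move=> uU; rewrite sigma_eq0; apply: contraTneq uU => ->; rewrite unitr0.
(* M and M_tr hold coordinates in their columns: hence the transpose. *)
have adj : (map_mx sigma M)^T *m gram beta1 f1 =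
           gram beta2 f2 *m map_mx sigma M_tr.
  apply/matrixP => k l; rewrite !mxE.
  transitivity (beta1 (pullback phi (f2 k)) (f1 l)).
    by rewrite M_phi form_suml; apply: eq_bigr => j _; rewrite !mxE.
  rewrite [LHS]hom_form_transpose M_phi_tr [LHS]form_sumr.
  by apply: eq_bigr => j _; rewrite !mxE mulrC.
(* A column x killed by M_tr is the coordinate vector of an equivariant f on
   R[S_1] with f o phi^tr = 0. *)
have Mtr0 : \det M_tr != 0.
  rewrite -det_tr; apply/negP => /det0P[x x0 xM]; case/eqP: x0.
  have sum0 : \sum_k x 0 k *: f1 k = 0.
    apply: (pullback_transpose_eq0 phi_inj).
    transitivity (\sum_k x 0 k *: pullback (transpose phi) (f1 k)).
      apply: hom_ext => s; rewrite comp_lfunE !sum_lfunE.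
      by apply: eq_bigr => k _; rewrite !scale_lfunE comp_lfunE.
    under eq_bigr do rewrite M_phi_tr scaler_sumr.
    rewrite exchange_big big1 //= => l _.
    under eq_bigr do rewrite scalerA.
    rewrite -scaler_suml; have /rowP/(_ l) := xM; rewrite !mxE.
    by under eq_bigr do rewrite mxE; move=> ->; rewrite scale0r.
  apply: (basis_inj f1_basis); first exact: G_hom_lincomb f1_basis.1.
  by rewrite sum0 big1 // => k _; rewrite mxE scale0r.
have := congr1 determinant adj.
rewrite !det_mulmx det_tr !det_map_mx G1 G2 => {}adj.
have M0 : sigma (\det M) != 0.
  apply: contra_neq Mtr0 => M0; apply/eqP; rewrite -sigma_eq0; move/eqP: adj.
  rewrite M0 mul0r eq_sym mulf_eq0 => /orP[|//].
  by rewrite mulf_eq0 (negPf nz2) orbF expf_eq0 (negPf (sigmaU _ u2U)).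
have -> : iota (tofrac (\det M_tr) / tofrac (\det M)) =
          sigma (\det M_tr) / sigma (\det M) by rewrite fmorph_div.
split; first by rewrite mulf_eq0 invr_eq0 (negPf M0) orbF sigma_eq0.
exists (u1 / u2); first by rewrite unitrM u1U unitrV.
have u20 := sigmaU _ u2U.
have -> : iota (tofrac (u1 / u2)) = sigma u1 / sigma u2.
  by rewrite -[LHS]/(sigma _) rmorphM rmorphV.
apply/eqP; rewrite expr_div_n mulf_div eqr_div ?mulf_neq0 ?expf_neq0 //.
by rewrite mulrC -adj mulrC.
Qed.
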